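(* Let $G$ be a compact Hausdorff topological group, let $X$ and $Y$ be arbitrary sets, let $\mathcal{H}$ be a family of mappings from $Y$ to $X$, let $Z$ be a Banach space, and let $E$ be a closed translation invariant (linear) subspace of $C(G)$. Let $S\colon \mathcal{H}\times E\times Z\longrightarrow[0,\infty)$ be an arbitrary map and let $R\colon G\times E\times Z\longrightarrow[0,\infty)$ be a map such that, for every $(T,b)\in E\times Z$, the function $R_{T,b}\colon G\longrightarrow[0,\infty)$, $R_{T,b}(\varphi)=R(\varphi,T,b)$, is continuous on $G$. Let $0<p<\infty$ and let $u\colon Y\longrightarrow X$ be a map in $\mathcal{H}$. Assume that: (a) $R(\varphi,T^{\phi},b)\leq R(\phi\varphi,T,b)$ for all $(T,b)\in E\times Z$ and all $\varphi,\phi\in G$; and (b) for every $b\in Z$, the map $S_{u,b}\colon E\longrightarrow[0,\infty)$ defined by $S_{u,b}(T)=S(u,T,b)$ is translation invariant. If $u$ is $R$-$S$-abstract $p$-summing, then the normalized Haar measure on $G$ is an $R$-$S$-abstract measure for $u$.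
   Context: $C(G)$ is the Banach space of continuous functions $G\to\mathbb{K}$ ($\mathbb{K}=\mathbb{R}$ or $\mathbb{C}$) with the sup norm; the group $G$ is written multiplicatively and is not necessarily abelian. For $T\in C(G)$ and $\phi\in G$, $T^{\phi}\in C(G)$ is defined by $T^{\phi}(\varphi)=T(\phi\varphi)$. A nonempty set $F\subset C(G)$ is called closed (left) translation invariant if $\{T^{\phi}: T\in F,\ \phi\in G\}\subset F$. If $F\subset C(G)$ is closed translation invariant and $W$ is any set, a map $v\colon F\to W$ is called translation invariant if $v(T)=v(T^{\phi})$ for all $T\in F$ and $\phi\in G$. A mapping $f\in\mathcal{H}$ is $R$-$S$-abstract $p$-summing if there is a constant $C>0$ such that $$\Big(\sum_{j=1}^{m}S(f,T_{j},b_{j})^{p}\Big)^{1/p}\leq C\cdot\Big(\sup_{\varphi\in G}\sum_{j=1}^{m}R(\varphi,T_{j},b_{j})^{p}\Big)^{1/p}$$ for all $m\in\mathbb{N}$ and all $(T_{j},b_{j})\in E\times Z$, $j=1,\ldots,m$. A regular Borel probability measure $\mu$ on $G$ is an $R$-$S$-abstract measure for $f\in\mathcal{H}$ if there is a constant $C>0$ such that $$S(f,T,b)\leq C\cdot\Big(\int_{G}R(\varphi,T,b)^{p}\,d\mu(\varphi)\Big)^{1/p}\quad\text{for all }(T,b)\in E\times Z.$$ The normalized Haar measure on $G$ is the unique translation invariant Radon probability measure $\sigma_G$ on the Borel sets of $G$, i.e. $\sigma_G(gB)=\sigma_G(B)$ for every Borel set $B$ and every $g\in G$. *)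

(* Defs.v *)
From HB Require Import structures.
From mathcomp Require Import all_boot all_order all_algebra.
From mathcomp Require Import all_classical all_reals all_analysis.
From mathcomp Require Import complex.

Set Implicit Arguments.
Unset Strict Implicit.
Unset Printing Implicit Defensive.

Import Order.TTheory GRing.Theory Num.Theory.
Import numFieldNormedType.Exports.

Local Open Scope classical_set_scope.
Local Open Scope ring_scope.

Variant scalarKind := RealScalars | ComplexScalars.

Definition scalars (RT : realType) (k : scalarKind) : numFieldType :=
  match k with
  | RealScalars => RT
  | ComplexScalars => (complex RT : numFieldType)
  end.

HB.mixin Record isTopologicalGroup G of Topological G & Group G := {
  mulg_continuous : continuous (fun x : G * G => (x.1 * x.2)%g) ;
  invg_continuous : continuous (fun x : G => x^-1%g)
}.

(* [Pointed] is only there because measurableType inherits from pointedType;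
   the chosen point is arbitrary and need not be the unit. *)
#[short(type="topologicalGroupType")]
HB.structure Definition TopologicalGroup :=
  {G of PointedTopological G & Group G & isTopologicalGroup G}.

Section vector_space_of_continuous_functions.
Variables (X : topologicalType) (K : numFieldType).
Local Notation C := (continuousType X K).
Implicit Types (f g h : C) (a : K).

Let zero_cts : continuous (fun _ : X => 0 : K).
Proof. by move=> x; exact: cvg_cst. Qed.

Let opp_cts f : continuous (fun x => - f x).
Proof. by move=> x; apply: continuousN; exact: cts_fun. Qed.

Let add_cts f g : continuous (fun x => f x + g x).
Proof. by move=> x; apply: continuousD; exact: cts_fun. Qed.

Let scale_cts a f : continuous (fun x => a * f x).
Proof. by move=> x; apply: continuousM; [exact: cvg_cst|exact: cts_fun]. Qed.

Definition cts_zero : C := mkcts zero_cts.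
Definition cts_opp f : C := mkcts (opp_cts (f := f)).
Definition cts_add f g : C := mkcts (add_cts (f := f) (g := g)).
Definition cts_scale a f : C := mkcts (scale_cts (a := a) (f := f)).

Let cts_addA : associative cts_add.
Proof. by move=> f g h; apply/continuousEP => x; exact: addrA. Qed.

Let cts_addC : commutative cts_add.
Proof. by move=> f g; apply/continuousEP => x; exact: addrC. Qed.

Let cts_add0 : left_id cts_zero cts_add.
Proof. by move=> f; apply/continuousEP => x; exact: add0r. Qed.

Let cts_addN : left_inverse cts_zero cts_opp cts_add.
Proof. by move=> f; apply/continuousEP => x; exact: addNr. Qed.

HB.instance Definition _ :=
  GRing.isZmodule.Build C cts_addA cts_addC cts_add0 cts_addN.

Let cts_scaleA a b f : cts_scale a (cts_scale b f) = cts_scale (a * b) f.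
Proof. by apply/continuousEP => x; exact: mulrA. Qed.

Let cts_scale1 : left_id 1 cts_scale.
Proof. by move=> f; apply/continuousEP => x; exact: mul1r. Qed.

Let cts_scaleDr : right_distributive cts_scale +%R.
Proof. by move=> a f g; apply/continuousEP => x; exact: mulrDr. Qed.

Let cts_scaleDl f : {morph cts_scale^~ f : a b / a + b}.
Proof. by move=> a b; apply/continuousEP => x; exact: mulrDl. Qed.

HB.instance Definition _ := GRing.Zmodule_isLmodule.Build K C
  cts_scaleA cts_scale1 cts_scaleDr cts_scaleDl.

End vector_space_of_continuous_functions.

Section translation_invariance.
Variables (G : topologicalGroupType) (K : numFieldType).
Implicit Types (F : set (continuousType G K)).

Let translate_cts (T : continuousType G K) (phi : G) :
  continuous (fun x => T (phi * x)%g).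
Proof.
move=> x; apply: (@continuous_comp _ _ _ (fun x : G => (phi * x)%g) T);
  last exact: cts_fun.
apply: (@continuous2_cvg _ _ _ _ _ _ (fun=> phi) id (fun a b : G => (a * b)%g)).
- exact: (@mulg_continuous G (phi, x)).
- exact: cvg_cst.
- exact: cvg_id.
Qed.

Definition translate (T : continuousType G K) (phi : G) : continuousType G K :=
  mkcts (translate_cts (T := T) (phi := phi)).

Definition closed_translation_invariant F : Prop :=
  F !=set0 /\ forall T phi, F T -> F (translate T phi).

Lemma translate_mem F (hF : closed_translation_invariant F) (T : F) (phi : G) :
  translate (val T) phi \in F.
Proof. by apply/mem_set/(proj2 hF)/set_mem/(valP T). Qed.

Definition translate_in F (hF : closed_translation_invariant F)
    (T : F) (phi : G) : F :=
  exist _ (translate (val T) phi) (translate_mem hF T phi).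

Definition translation_invariant_map F (hF : closed_translation_invariant F)
    (W : Type) (v : F -> W) : Prop :=
  forall (T : F) (phi : G), v T = v (translate_in hF T phi).

End translation_invariance.

Notation borelType G := (g_sigma_algebraType (@open G)).

Section borel_measures.
Variables (RT : realType) (G : topologicalGroupType).
Implicit Types mu : probability (borelType G) RT.

Definition inner_regular mu : Prop :=
  forall B : set (borelType G), measurable B ->
    mu B = ereal_sup [set mu K | K in [set K : set G | compact K /\ K `<=` B]].

Definition outer_regular mu : Prop :=
  forall B : set (borelType G), measurable B ->
    mu B = ereal_inf [set mu U | U in [set U : set G | open U /\ B `<=` U]].

(* Finiteness on compact sets is automatic for a probability measure. *)
Definition radon mu : Prop := inner_regular mu.

Definition regular_borel mu : Prop := inner_regular mu /\ outer_regular mu.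

Definition normalized_haar mu : Prop :=
  radon mu /\
  forall (g : G) (B : set (borelType G)), measurable B ->
    mu [set (g * x)%g | x in (B : set G)] = mu B.

End borel_measures.

Section abstract_summability.
Variables (RT : realType) (G : topologicalGroupType) (H E Z : Type).
Variables (S : H -> E -> Z -> {nonneg RT}) (R : G -> E -> Z -> {nonneg RT}).
Variable p : RT.

(* The supremum is taken in the extended reals, so it is meaningful even if R is
   unbounded; likewise for the integral below. *)
Definition abstract_summing (f : H) : Prop :=
  exists2 C : RT, 0 < C &
    forall (m : nat) (T : 'I_m -> E) (b : 'I_m -> Z),
      (((\sum_(j < m) (S f (T j) (b j))%:num `^ p) `^ p^-1)%:E <=
       C%:E * ereal_sup [set (\sum_(j < m) (R x (T j) (b j))%:num `^ p)%R%:E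
                        | x in [set: G]] `^ p^-1)%E.

Definition abstract_measure (f : H) (mu : probability (borelType G) RT) : Prop :=
  regular_borel mu /\
  exists2 C : RT, 0 < C &
    forall (T : E) (b : Z),
      ((S f T b)%:num%:E <=
       C%:E * (\int[mu]_(x in [set: borelType G])
                 ((R x T b)%:num `^ p)%:E) `^ p^-1)%E.

End abstract_summability.

(* Main.v *)
(** Applying summability to the translates [T^(g_1), ..., T^(g_m)] of one [T],
    and using (a) and (b), gives
    [m * S(T,b)^p <= C^p * sup_x \sum_j f (g_j x)] with [f x = R(x,T,b)^p].
    Repeating the [g_j] replaces the counting measure by arbitrary weights, so
    it suffices that averages of left translates of [f] come uniformly close to
    [\int f]. Left invariance makes [c = \int f (g^-1 x) dmu(g)]
    independent of [x]; that integral is uniformly approximated by finite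
    averages [\sum_i w_i f (g_i^-1 x)], and integrating these in [x] shows
    [c <= \int f]. *)
Require Import Defs.
From mathcomp Require Import all_boot all_order all_algebra.
From mathcomp Require Import all_classical all_reals all_analysis.
From mathcomp Require Import measurable_realfun.

Set Implicit Arguments.
Unset Strict Implicit.
Unset Printing Implicit Defensive.

Import Order.TTheory GRing.Theory Num.Theory.
Import numFieldNormedType.Exports.
Local Open Scope classical_set_scope.
Local Open Scope ring_scope.

(** * Borel measurability and continuity of translations *)

Lemma open_borel_measurable (G : topologicalGroupType) (U : set G) :
  open U -> measurable (U : set (borelType G)).
Proof. by move=> oU; apply: sub_sigma_algebra. Qed.

Lemma continuous_borel_measurable (G G' : topologicalGroupType) (f : G -> G') :
  continuous f ->
  measurable_fun [set: borelType G] (f : borelType G -> borelType G').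
Proof.
move=> /continuousP cf.
apply: (@measurability _ _ (borelType G) (borelType G') setT f
  (@open G') erefl).
move=> _ [U oU <-].
by rewrite setTI; apply: open_borel_measurable; exact: cf.
Qed.

Lemma continuous_borel_measurable_real (RT : realType)
    (G : topologicalGroupType) (f : G -> RT) :
  continuous f -> measurable_fun [set: borelType G] (f : borelType G -> RT).
Proof.
move=> /continuousP cf.
apply: (@measurability _ _ (borelType G) _ setT f _
  (RGenOInfty.measurableE RT)).
move=> _ [_ [x ->] <-]; rewrite setTI.
by apply: open_borel_measurable; exact: cf.
Qed.

Lemma mulg_continuous2 (T : topologicalType) (G : topologicalGroupType)
    (f g : T -> G) :
  continuous f -> continuous g -> continuous (fun x => f x * g x)%g.
Proof.
move=> cf cg x.
apply: (@continuous2_cvg _ _ _ _ _ _ f g (fun a b : G => a * b)%g).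
- exact: (@mulg_continuous G (f x, g x)).
- exact: cf.
- exact: cg.
Qed.

Lemma lmulg_continuous (G : topologicalGroupType) (g : G) :
  continuous (fun x : G => g * x)%g.
Proof. by apply: mulg_continuous2 => x; [exact: cvg_cst | exact: cvg_id]. Qed.

(** * Regularity and left invariance of the Haar measure *)

(** Outer regularity at [B] is inner regularity at its complement: in a Hausdorff space a compact
    [K] disjoint from [B] is closed, so its complement is an open superset of [B], of mass
    [1 - mu K]. This supplies the half of [regular_borel] that [radon] does not state. *)
Lemma inner_regular_outer_regular (RT : realType) (G : topologicalGroupType)
    (mu : probability (borelType G) RT) :
  hausdorff_space G -> inner_regular mu -> outer_regular mu.
Proof.
move=> hG iG B mB; apply/eqP; rewrite eq_le; apply/andP; split.
  apply: le_ereal_inf_tmp => _ [U [oU BU] <-].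
  by apply: le_measure => //; rewrite inE //; exact: open_borel_measurable.
have mK (K : set G) : compact K -> measurable (~` K : set (borelType G)).
  move=> /(compact_closed hG) cK.
  by apply: open_borel_measurable; exact: closed_openC.
have -> : mu B = (1 - mu (~` B))%E.
  by rewrite -probability_setC ?setCK//; exact: measurableC.
rewrite (iG (~` B)); last exact: measurableC.
rewrite leeBrDr; last first.
  rewrite -iG; last exact: measurableC.
  by rewrite fin_num_measure//; exact: measurableC.
have infE (K : set G) : compact K -> K `<=` ~` B ->
    (ereal_inf [set mu U | U in [set U : set G | open U /\ B `<=` U]] <=
     1 - mu K)%E.
  move=> cK KB; rewrite -probability_setC; last first.
    by rewrite -[K]setCK; apply: measurableC; exact: mK.
  apply: ereal_inf_lbound; exists (~` K) => //; split.
    by apply: closed_openC; exact: compact_closed.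
  by move=> x Bx /KB.
(* The empty compact set bounds the infimum by 1. Being finite, the infimum can be moved across the
   inequality, which leaves an upper bound on a supremum over [K]. *)
have inf_fin : ereal_inf [set mu U | U in [set U : set G | open U /\ B `<=` U]]
    \is a fin_num.
  rewrite ge0_fin_numE.
    apply: le_lt_trans (infE set0 compact0 (@sub0set _ _)) _.
    by rewrite measure0 sube0 ltry.
  by apply: le_ereal_inf_tmp => _ [U _ <-].
rewrite addeC -leeBrDr//.
apply: ge_ereal_sup => _ [K [cK KB] <-].
have Kfin : mu K \is a fin_num.
  by rewrite fin_num_measure// -[K]setCK; apply: measurableC; exact: mK.
by rewrite leeBrDr// addeC -leeBrDr//; exact: infE.
Qed.

(** [mu] equals its pushforward under left multiplication by [g], because translating the preimage
    of [A] by [g] gives back [A]. *)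
Lemma haar_ge0_integral_lmulg (RT : realType) (G : topologicalGroupType)
    (mu : probability (borelType G) RT) (g : G) (f : borelType G -> \bar RT) :
  normalized_haar mu ->
  measurable_fun [set: borelType G] f -> (forall x, (0 <= f x)%E) ->
  (\int[mu]_x f (g * x)%g = \int[mu]_x f x)%E.
Proof.
move=> [_ invmu] mf f0.
have mg := continuous_borel_measurable (@lmulg_continuous _ g).
rewrite -[LHS](ge0_integral_pushforward mg mu measurableT mf)//.
apply: eq_measure_integral => A mA _.
have pA : measurable ((fun x => g * x)%g @^-1` A : set (borelType G)).
  by have := mg measurableT _ mA; rewrite setTI.
rewrite -[RHS]/(mu A) -[LHS](invmu g _ pA).
congr (mu _); apply/seteqP; split => [_ [x/= Ax <-]//|x Ax].
by exists (g^-1 * x)%g; rewrite /= mulgA mulgV mul1g.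
Qed.

(** * Approximation tools: step functions, translates, weights, powers *)

(** The error [e] on each piece adds up to [e] times the total mass, which is 1. Both bounds are
    additive, so that only integrals of nonnegative functions occur. *)
Lemma step_integral_approx (RT : realType) (d : measure_display)
    (T : measurableType d) (mu : probability T RT) (n : nat)
    (A : nat -> set T) (f : T -> RT) (a : nat -> RT) (e : RT) :
  (forall i, measurable (A i)) -> trivIset [set: nat] A ->
  \big[setU/set0]_(0 <= i < n) A i = [set: T] ->
  measurable_fun [set: T] f -> (forall x, 0 <= f x) -> (forall i, 0 <= a i) ->
  0 <= e -> (forall i x, A i x -> `|f x - a i| <= e) ->
  (\sum_(0 <= i < n) (a i)%:E * mu (A i) <= \int[mu]_x (f x)%:E + e%:E)%E /\
  (\int[mu]_x (f x)%:E <= \sum_(0 <= i < n) (a i)%:E * mu (A i) + e%:E)%E.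
Proof.
move=> mA tA AT mf f0 a0 e0 fa.
have tA' : trivIset [set` index_iota 0 n] A.
  by move=> i j _ _; exact: tA.
have mfE (D : set T) : measurable D -> measurable_fun D (EFin \o f).
  by move=> mD; apply/measurable_EFinP; exact: measurable_funS mf.
have splitE : (\int[mu]_x (f x)%:E =
    \sum_(0 <= i < n) \int[mu]_(x in A i) (f x)%:E)%E.
  rewrite -[X in integral _ X]AT ge0_integral_bigsetU ?iota_uniq//.
  - by rewrite AT; exact: mfE.
  - by move=> x _; rewrite lee_fin.
have massE : (\sum_(0 <= i < n) e%:E * mu (A i) = e%:E)%E.
  rewrite -ge0_sume_distrr; last by move=> i _; exact: measure_ge0.
  rewrite big_mkord -measure_bigsetU//.
  rewrite -(big_mkord xpredT A) AT.
  by rewrite [X in (_ * X)%E](probability_setT mu) mule1.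
rewrite splitE -massE -!big_split/=; split; apply: lee_sum => i _.
  rewrite -!integral_cst// -ge0_integralD//; first last.
  - exact: mfE.
  - by move=> x _; rewrite lee_fin.
  apply: ge0_le_integral => //.
  - by move=> x _; rewrite lee_fin.
  - by apply: emeasurable_funD => //; exact: mfE.
  - move=> x Aix; rewrite /cst -EFinD lee_fin -lerBlDl.
    by apply: le_trans (fa _ _ Aix); rewrite distrC ler_norm.
rewrite -!integral_cst// -ge0_integralD//; last by move=> x _; rewrite lee_fin.
apply: ge0_le_integral => //.
- by move=> x _; rewrite lee_fin.
- exact: mfE.
- move=> x Aix; rewrite /cst -EFinD lee_fin -lerBlDl.
  by apply: le_trans (fa _ _ Aix); rewrite ler_norm.
Qed.

(** Joint continuity of [f (h^-1 * x)] gives each [x] its own neighbourhood of [g]; compactness, as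
    a near-covering property, yields one that serves all [x]. *)
Lemma left_translate_near (RT : realType) (G : topologicalGroupType)
    (f : G -> RT) (g : G) (e : RT) :
  compact [set: G] -> continuous f -> 0 < e ->
  \forall h \near g, forall x, `|f (h^-1 * x)%g - f (g^-1 * x)%g| <= e.
Proof.
move=> /compact_near_coveringP cG cf e0.
pose F (z : G * G) := f (z.2^-1 * z.1)%g.
have cF : continuous F.
  move=> z; apply: (@continuous_comp _ _ _ (fun z : G * G => z.2^-1 * z.1)%g f);
    last exact: cf.
  apply: mulg_continuous2 => {}z; last exact: cvg_fst.
  apply: (@continuous_comp _ _ _ snd (fun x : G => x^-1)%g);
    first exact: cvg_snd.
  exact: invg_continuous.
have e20 : 0 < e / 2 by rewrite divr_gt0.
suff : \forall h \near g, [set: G] `<=`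
    (fun x => `|f (h^-1 * x)%g - f (g^-1 * x)%g| <= e).
  by apply: filterS => h hh x; exact: hh.
apply: cG => x _.
have /cvgrPdist_le/(_ _ e20) Fnear : F z @[z --> (x, g)] --> F (x, g).
  exact: cF.
(* Here [h] is a dummy: [V] contains [g], so the estimate also applies at [(y, g)]. Both [F (y, h)]
   and [F (y, g)] are then within [e / 2] of [F (x, g)]. *)
have slice : \forall y \near x & h \near g, `|F (x, g) - F (y, g)| <= e / 2.
  case: Fnear => -[/= U V] [xU gV] UV; exists (U, V) => //= -[y h] [/= Uy _].
  by apply: (UV (y, g)); split => //; exact: nbhs_singleton.
apply: filterS2 Fnear slice => -[y h] /= Fyh Fyg.
rewrite -[X in `|X|](subrKA (F (x, g))) (le_trans (ler_normD _ _))//.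
by rewrite (splitr e) lerD// distrC.
Qed.

(* The real weights [w i] are approximated by the multiplicities
   [truncn (N * w i)] for large [N]. *)
Lemma le_of_counting (RT : realType) (I P : Type) (F : I -> P -> RT)
    (a K B : RT) (n : nat) (g : nat -> I) (w : nat -> RT) :
  (forall i x, 0 <= F i x) -> 0 <= a ->
  (forall (s : seq I) (M : RT), (forall x, \sum_(i <- s) F i x <= M) ->
     (size s)%:R * a <= K * M) ->
  (forall i, 0 <= w i) -> \sum_(0 <= i < n) w i = 1 ->
  (forall x, \sum_(0 <= i < n) w i * F (g i) x <= B) ->
  a <= K * B.
Proof.
move=> F0 a0 count w0 w1 FB.
apply/ler_addgt0Pr => e e0.
(* Rounding down costs at most one copy for each of the [n] weights, hence at most [n * a] in total;
   [N] makes this smaller than [N * e]. *)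
pose N := (Num.truncn (n%:R * a / e)).+1.
have Ne : n%:R * a < N%:R * e.
  by rewrite -ltr_pdivrMr//; exact: truncnS_gt.
pose m i := Num.truncn (N%:R * w i).
have mle i : (m i)%:R <= N%:R * w i by rewrite truncn_le// mulr_ge0.
have mge i : N%:R * w i - 1 <= (m i)%:R.
  by rewrite lerBlDr natr1 ltW// truncnS_gt.
pose s := flatten [seq nseq (m i) (g i) | i <- index_iota 0 n].
have sizes : N%:R - n%:R <= (size s)%:R :> RT.
  rewrite size_flatten /shape -map_comp sumnE big_map natr_sum.
  apply: (@le_trans _ _ (\sum_(0 <= i < n) (N%:R * w i - 1))).
    by rewrite sumrB -mulr_sumr w1 mulr1 sumr_const_nat subn0.
  by apply: ler_sum => i _; rewrite /= size_nseq.
have /count : forall x, \sum_(i <- s) F i x <= N%:R * B.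
  move=> x; rewrite big_flatten big_map.
  apply: le_trans (ler_wpM2l (ler0n _ N) (FB x)).
  rewrite mulr_sumr; apply: ler_sum => i _.
  by rewrite big_nseq iter_addr_0 -[leLHS]mulr_natl mulrA ler_wpM2r.
move=> sB.
have N0 : 0 < N%:R :> RT by rewrite ltr0n.
rewrite -(ler_pM2l N0) mulrDr.
have := ler_wpM2r a0 sizes.
rewrite mulrBl => le1.
have := le_trans le1 sB; rewrite lerBlDr => /le_trans; apply.
by rewrite mulrCA lerD2l ltW.
Qed.

Lemma continuous_powR_ge0 (RT : realType) (T : topologicalType) (f : T -> RT)
    (p : RT) :
  0 < p -> continuous f -> (forall x, 0 <= f x) ->
  continuous (fun x => f x `^ p).
Proof.
move=> p0 cf f0 x.
have := f0 x; rewrite le_eqVlt => /predU1P[fx0|fx0]; last first.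
  suff : {for x, continuous (fun y => expR (p * ln (f y)))}.
    have powE : \forall y \near x, expR (p * ln (f y)) = f y `^ p.
      have : \forall y \near x, 0 < f y.
        by apply: (cvgr_gt (f x)) => //; exact: cf.
      by apply: filterS => y fy; rewrite /powR gt_eqF.
    rewrite /prop_for /continuous_at (nbhs_singleton powE) => cexp.
    exact: cvg_trans (near_eq_cvg powE) cexp.
  apply: (@continuous_comp _ _ _ (fun y => p * ln (f y)) expR);
    last exact: continuous_expR.
  apply: (@continuousM _ _ (fun=> p) (fun y => ln (f y))); first exact: cvg_cst.
  by apply: (@continuous_comp _ _ _ f (@ln RT));
    [exact: cf|exact: continuous_ln].
rewrite /continuous_at -fx0 powR0 ?gt_eqF//.
apply/cvgrPdist_le => e e0.
have : \forall y \near x, `|f x - f y| <= e `^ p^-1.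
  by move/cvgrPdist_le: (cf x); apply; exact: powR_gt0.
rewrite -fx0; apply: filterS => y.
rewrite !sub0r !normrN !ger0_norm ?powR_ge0// => fy.
have -> : e = (e `^ p^-1) `^ p.
  by rewrite -powRrM mulVf ?gt_eqF// powRr1// ltW.
by apply: ge0_ler_powR; rewrite ?nnegrE ?powR_ge0 ?(ltW p0).
Qed.

(** * Averages of translates against the Haar integral *)

(** Compactness cuts [G] into finitely many pieces on which the translate of [f] varies little,
    uniformly in [x]; the masses of the pieces are the weights. Swapping a finite sum with an
    integral then does the work of Fubini. *)
Lemma haar_translate_average (RT : realType) (G : topologicalGroupType)
    (mu : probability (borelType G) RT) (f : G -> RT) (e : RT) :
  compact [set: G] -> normalized_haar mu -> continuous f ->
  (forall x, 0 <= f x) -> 0 < e ->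
  exists (n : nat) (g : nat -> G) (w : nat -> RT),
    [/\ forall i, 0 <= w i, \sum_(0 <= i < n) w i = 1 &
      forall x, ((\sum_(0 <= i < n) w i * f (g i * x)%g)%:E <=
                 \int[mu]_y (f y)%:E + e%:E)%E].
Proof.
move=> cG haar cf f0 e0.
have e20 : 0 < e / 2 by rewrite divr_gt0.
pose V g := interior
  [set h | forall x, `|f (h^-1 * x)%g - f (g^-1 * x)%g| <= e / 2].
have : cover_compact [set: G] by rewrite -compact_cover.
move=> /(_ _ [set: G] V (fun g _ => @open_interior _ _)) [].
  by move=> g _; exists g => //; exact: left_translate_near.
move=> D _ DV.
pose n := size (finmap.enum_fset D).
(* Past [n] the default [point] still gives a genuine [V (g i)], so the estimate on [A i] holds for
   every index, as [step_integral_approx] demands. *)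
pose g i := nth point (finmap.enum_fset D) i.
pose A := seqDU (fun i => V (g i)) : nat -> set (borelType G).
have mA i : measurable (A i).
  apply: seqDU_measurable => {}i; apply: open_borel_measurable.
  exact: open_interior.
have tA : trivIset [set: nat] A by exact: trivIset_seqDU.
have AT : \big[setU/set0]_(0 <= i < n) A i = [set: borelType G].
  rewrite big_mkord -bigsetU_seqDU -(bigcup_mkord n (fun i => V (g i))).
  apply/seteqP; split=> // x _.
  have [h /= hD hx] := DV x I; exists (index h (finmap.enum_fset D)).
    by rewrite /= index_mem.
  by rewrite /g nth_index.
pose w i := fine (mu (A i)).
have wE i : mu (A i) = (w i)%:E by rewrite fineK// fin_num_measure.
(* [f (z^-1 * x) = h (x^-1 * z)], a left translate in [z]. *)
pose h x := f x^-1%g.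
have h0 x : 0 <= h x by exact: f0.
have ch : continuous h.
  by move=> x; apply: continuous_comp; [exact: invg_continuous|exact: cf].
have chx x : continuous (fun z => h (x^-1 * z)%g).
  move=> z; apply: (@continuous_comp _ _ _ (fun z => x^-1 * z)%g h);
    [exact: lmulg_continuous|exact: ch].
have near_fA i z x : A i z -> `|h (x^-1 * z)%g - f ((g i)^-1 * x)%g| <= e / 2.
  move=> Aiz; have Vz : V (g i) z by exact: subset_seqDU Aiz.
  have : forall y, `|f (z^-1 * y)%g - f ((g i)^-1 * y)%g| <= e / 2.
    exact: interior_subset Vz.
  by move=> /(_ x); rewrite /h invgM invgK.
have approx x := step_integral_approx mu mA tA AT
  (continuous_borel_measurable_real (chx x))
  (fun z => f0 _) (fun i => f0 ((g i)^-1 * x)%g) (ltW e20)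
  (fun i z => @near_fA i z x).
have hE x : (\int[mu]_z (h (x^-1 * z)%g)%:E = \int[mu]_z (h z)%:E)%E.
  rewrite (haar_ge0_integral_lmulg _ (f := EFin \o h))//.
  by apply/measurable_EFinP; exact: continuous_borel_measurable_real.
have sumE x : (\sum_(0 <= i < n) (f ((g i)^-1 * x)%g)%:E * mu (A i) =
    (\sum_(0 <= i < n) w i * f ((g i)^-1 * x)%g)%:E)%E.
  by rewrite -sumEFin; apply: eq_bigr => i _; rewrite wE -EFinM mulrC.
have w0 i : 0 <= w i by exact: fine_ge0.
have w1 : \sum_(0 <= i < n) w i = 1.
  apply: EFin_inj; rewrite -sumEFin -(probability_setT mu) -AT !big_mkord.
  rewrite measure_bigsetU//.
  by apply: eq_bigr => i _; exact: esym (wE i).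
have le_h x : ((\sum_(0 <= i < n) w i * f ((g i)^-1 * x)%g)%:E <=
    \int[mu]_z (h z)%:E + (e / 2)%:E)%E.
  rewrite -sumE -(hE x); exact: (approx x).1.
(* Left invariance alone does not undo the inversion in [h] by a change of variable. Instead the
   constant [\int h] is integrated over [x] and compared with the step sums, whose translates of [f]
   all integrate to [\int f]. *)
have h_le : (\int[mu]_z (h z)%:E <= \int[mu]_z (f z)%:E + (e / 2)%:E)%E.
  have mfg i : measurable_fun [set: borelType G]
      (fun x : borelType G => f ((g i)^-1 * x)%g).
    apply: continuous_borel_measurable_real => z.
    by apply: (@continuous_comp _ _ _ _ f); [exact: lmulg_continuous|exact: cf].
  have int_fg i : (\int[mu]_x ((w i)%:E * (f ((g i)^-1 * x)%g)%:E) =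
      (w i)%:E * \int[mu]_x (f x)%:E)%E.
    rewrite ge0_integralZl ?lee_fin//; first last.
    - by move=> x _; rewrite lee_fin.
    - exact/measurable_EFinP.
    congr (_ * _)%E; apply: (haar_ge0_integral_lmulg _ (f := EFin \o f)) => //.
    by apply/measurable_EFinP; exact: continuous_borel_measurable_real.
  have -> : (\int[mu]_z (f z)%:E + (e / 2)%:E = \int[mu]_x
      (\sum_(0 <= i < n) (w i)%:E * (f ((g i)^-1 * x)%g)%:E + (e / 2)%:E))%E.
    rewrite ge0_integralD//; first last.
    - by move=> x _; rewrite lee_fin ltW.
    - apply: emeasurable_sum => i.
      by apply/measurable_EFinP; apply: measurable_funM.
    - by move=> x _; apply: sume_ge0 => i _; rewrite -EFinM lee_fin mulr_ge0.
    rewrite ge0_integral_sum//; first last.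
    - by move=> i x _; rewrite -EFinM lee_fin mulr_ge0.
    - by move=> i; apply/measurable_EFinP; apply: measurable_funM.
    rewrite integral_cst// [X in (_ * X)%E](probability_setT mu) mule1.
    congr (_ + _)%E.
    under eq_bigr do rewrite int_fg.
    rewrite -ge0_sume_distrl ?sumEFin ?w1 ?mul1e// => i _.
    by rewrite lee_fin.
  rewrite -[leLHS]mule1 -(probability_setT mu) -integral_cst//.
  apply: ge0_le_integral => //.
  - by move=> x _; apply: integral_ge0 => z _; rewrite lee_fin.
  - apply: emeasurable_funD => //; apply: emeasurable_sum => i.
    by apply/measurable_EFinP; apply: measurable_funM.
  - move=> x _; rewrite /cst -(hE x).
    apply: le_trans (approx x).2 _.
    by rewrite sumE -sumEFin.
exists n, (fun i => (g i)^-1)%g, w; split=> // x.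
rewrite (splitr e) EFinD addeA; apply: le_trans (le_h x) _.
exact: leeD2r.
Qed.

(** * From summability to the bound by the Haar integral *)

Theorem theorem3p1 (RT : realType) (k : scalarKind)
  (G : topologicalGroupType)
  (compactG : compact [set: G]) (hausdorffG : hausdorff_space G)
  (X Y : Type) (H : set (Y -> X))
  (Z : completeNormedModType (scalars RT k))
  (E : set (continuousType G (scalars RT k)))
  (subspaceE : GRing.submod_closed [in E])
  (invE : closed_translation_invariant E)
  (S : H -> E -> Z -> {nonneg RT})
  (R : G -> E -> Z -> {nonneg RT})
  (R_continuous : forall (T : E) (b : Z),
     continuous (fun x : G => (R x T b)%:num : RT))
  (p : RT) (p_gt0 : 0 < p) (u : H)
  (R_translate : forall (T : E) (b : Z) (x phi : G),
     (R x (translate_in invE T phi) b)%:num <= (R (phi * x)%g T b)%:num)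
  (S_invariant : forall b : Z,
     translation_invariant_map invE (fun T : E => S u T b)) :
  abstract_summing S R p u ->
  forall mu : probability (borelType G) RT,
    normalized_haar mu -> abstract_measure S R p u mu.
Proof.
move=> [C C0 summing] mu haar; split.
  by split; [exact: haar.1|exact: inner_regular_outer_regular haar.1].
exists C => // T b.
have pV0 : 0 < p^-1 by rewrite invr_gt0.
(* Since [C > 0], an infinite integral makes the right-hand side infinite; from here on the integral
   is a real number. *)
have [->|ifty] := eqVneq (\int[mu]_x ((R x T b)%:num `^ p)%:E)%E +oo%E.
  by rewrite poweRyr ?gt_eqF// gt0_muley ?lte_fin// leey.
pose f (x : G) := (R x T b)%:num `^ p.
have f0 x : 0 <= f x by exact: powR_ge0.
have cf : continuous f by exact: continuous_powR_ge0.
have If0 : (0 <= \int[mu]_x (f x)%:E)%E.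
  by apply: integral_ge0 => x _; rewrite lee_fin.
have Ifin : (\int[mu]_x (f x)%:E)%E \is a fin_num.
  by rewrite ge0_fin_numE// ltey.
pose I := fine (\int[mu]_x (f x)%:E)%E.
have IE : (\int[mu]_x (f x)%:E)%E = I%:E by rewrite fineK.
have I0 : 0 <= I by exact: fine_ge0.
set a := (S u T b)%:num.
have a0 : 0 <= a by rewrite /a.
have powRVK (x : RT) : 0 <= x -> (x `^ p^-1) `^ p = x.
  by move=> x0; rewrite -powRrM mulVf ?gt_eqF// powRr1.
have powRKV (x : RT) : 0 <= x -> (x `^ p) `^ p^-1 = x.
  by move=> x0; rewrite -powRrM mulfV ?gt_eqF// powRr1.
have count (s : seq G) (M : RT) :
    (forall x, \sum_(g <- s) f (g * x)%g <= M) ->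
    (size s)%:R * a `^ p <= C `^ p * M.
  move=> sM.
  (* [point] serves as an element of [G], at which [M] dominates a nonnegative sum. *)
  have M0 : 0 <= M by apply: le_trans (sM point); exact: sumr_ge0.
  have := summing (size s) (fun j => translate_in invE T (tnth (in_tuple s) j))
    (fun=> b).
  under eq_bigr do rewrite -S_invariant -/a.
  rewrite sumr_const card_ord -[_ *+ _]mulr_natl => sum_le.
  have /(le_trans sum_le) :
      (C%:E * ereal_sup [set (\sum_(j < size s)
         (R x (translate_in invE T (tnth (in_tuple s) j)) b)%:num `^ p)%R%:E
         | x in [set: G]] `^ p^-1 <= (C * M `^ p^-1)%:E)%E.
    rewrite EFinM -poweR_EFin lee_pmul2l ?lte_fin//.
    have supM : (ereal_sup [set (\sum_(j < size s)
         (R x (translate_in invE T (tnth (in_tuple s) j)) b)%:num `^ p)%R%:E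
         | x in [set: G]] <= M%:E)%E.
      apply: ge_ereal_sup => _ [x _ <-]; rewrite lee_fin.
      apply: le_trans (sM x); rewrite [leRHS]big_tnth; apply: ler_sum => j _.
      (* Assumption (a), [R_translate], closes the remaining comparison of the bases. *)
      by apply: ge0_ler_powR; rewrite ?nnegrE ?(ltW p_gt0).
    apply: gt0_ler_poweR => //; first exact: ltW.
      rewrite in_itv/= leey andbT; apply: le_ereal_sup_tmp.
      exists (\sum_(j < size s)
         (R point (translate_in invE T (tnth (in_tuple s) j)) b)%:num
         `^ p)%R%:E.
        by exists point.
      by rewrite lee_fin sumr_ge0// => j _; exact: powR_ge0.
    by rewrite in_itv/= leey andbT lee_fin.
  rewrite lee_fin => /(ge0_ler_powR (ltW p_gt0)).
  rewrite !nnegrE => /(_ (powR_ge0 _ _)).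
  rewrite mulr_ge0 ?powR_ge0 ?(ltW C0)// => /(_ isT).
  rewrite powRVK ?mulr_ge0 ?powR_ge0//.
  by rewrite powRM ?powR_ge0 ?(ltW C0)// powRVK.
have aI : a `^ p <= C `^ p * I.
  apply/ler_addgt0Pr => e e0.
  have Cp0 : 0 < C `^ p by exact: powR_gt0.
  have eC0 : 0 < e / C `^ p by exact: divr_gt0.
  have [n [g [w [w0 w1 wf]]]] := haar_translate_average compactG haar cf f0 eC0.
  have -> : C `^ p * I + e = C `^ p * (I + e / C `^ p).
    by rewrite mulrDr mulrCA mulfV ?mulr1// gt_eqF.
  apply: (le_of_counting (F := fun g x => f (g * x)%g) _ _ count w0 w1) => //.
    exact: powR_ge0.
  by move=> x; rewrite -lee_fin EFinD -IE; exact: wf.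
rewrite -[X in (C%:E * (X `^ _))%E]/(\int[mu]_x (f x)%:E)%E IE poweR_EFin.
rewrite -EFinM lee_fin -(powRKV _ a0) -{1}(powRKV C) ?(ltW C0)//.
rewrite -powRM ?powR_ge0//.
by apply: ge0_ler_powR; rewrite ?nnegrE ?mulr_ge0 ?powR_ge0 ?(ltW pV0).
Qed.
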